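(* Let $n\ge4$. Let $A=(a_{ij})$ be the $n\times n$ matrix with $a_{12}=a_{21}=1$ and all other entries $0$. Let $$\gamma=\frac{-n^2+5n-8}{8(n-2)}$$ and let $B=(b_{ij})$ be the $n\times n$ matrix with $b_{ij}=0$ if $i=j$; $b_{ij}=\gamma$ if $i\le2$ and $j\ge3$, or if $j\le2$ and $i\ge3$; and $b_{ij}=1/2$ otherwise. Let $f:S_n\to\mathbb{R}$ be defined by $f(\sigma)=\sum_{i,j=1}^n b_{\sigma(i)\sigma(j)}a_{ij}$. Then: (i) the average value of $f$ on $S_n$ is $0$; (ii) the maximum value of $f$ on $S_n$ is $1$ and is attained, in particular, at the identity permutation $e$; (iii) for every integer $2\le k\le n$, with $U(e,k)=\{\sigma\in S_n:|\{i:\sigma(i)\ne i\}|=k\}$, one has $$\frac1{|U(e,k)|}\sum_{\sigma\in U(e,k)}f(\sigma)\le\frac{-nk+k^2+3n-k-4}{2n-4}.$$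
   Context: $S_n$ is the group of permutations of $\{1,\dots,n\}$. *)

(* Defs.v *)
From mathcomp Require Import all_boot all_order all_algebra all_fingroup.
From mathcomp Require Import reals.
Set Implicit Arguments.
Unset Strict Implicit.
Unset Printing Implicit Defensive.
Import Order.TTheory GRing.Theory Num.Theory.
Local Open Scope ring_scope.

(* Indices {1,...,n} are represented by 'I_n = {0,...,n-1}: the index i of the
   text is the ordinal of value i - 1, so that "i <= 2" reads (i < 2)%N and
   "i >= 3" reads (2 <= i)%N. *)

Definition matA (R : realType) (n : nat) : 'M[R]_n :=
  \matrix_(i < n, j < n)
    (if ((i == 0 :> nat) && (j == 1 :> nat))
        || ((i == 1 :> nat) && (j == 0 :> nat)) then 1 else 0).

Definition gam (R : realType) (n : nat) : R :=
  (- n%:R ^+ 2 + 5 * n%:R - 8) / (8 * (n%:R - 2)).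

Definition matB (R : realType) (n : nat) : 'M[R]_n :=
  \matrix_(i < n, j < n)
    (if i == j then 0
     else if ((i < 2)%N && (2 <= j)%N) || ((j < 2)%N && (2 <= i)%N)
       then gam R n
     else 1 / 2).

Definition qap (R : realType) (n : nat) (A B : 'M[R]_n) (s : 'S_n) : R :=
  \sum_(i < n) \sum_(j < n) B (s i) (s j) * A i j.

Definition average (R : realType) (T : finType) (X : {set T}) (f : T -> R) : R :=
  (#|X|%:R)^-1 * \sum_(x in X) f x.

(* U(e,k): the permutations moving exactly k points. *)
Definition sphere_id (n k : nat) : {set 'S_n} :=
  [set s : 'S_n | #|[set i : 'I_n | s i != i]| == k].

(* Main.v *)
Require Import Defs.
From mathcomp Require Import all_boot all_order all_algebra all_fingroup.
From mathcomp Require Import reals.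
From mathcomp Require Import zify ring lra.
Set Implicit Arguments.
Unset Strict Implicit.
Unset Printing Implicit Defensive.
Import Order.TTheory GRing.Theory Num.Theory.
Local Open Scope ring_scope.

(** [f] takes the value [1] unless exactly one of [s 1], [s 2] lies in [{1, 2}]
    (call [s] mixed), where it takes the value [2 * gam]. Fixing one of the
    points [1], [2] and moving the other makes [s] mixed. As the symmetric
    group is 2-transitive and [U(e,k)] is closed under conjugation, this happens
    with probability [2k(n-k)/(n(n-1))] on [U(e,k)], and [1 - 2 * gam] is
    [n(n-1)/(4(n-2))], so the average is at most [1 - k(n-k)/(2(n-2))]. *)

(** * Averages over ordered pairs of distinct points *)

Lemma perm_two_transitive (T : finType) (i j i' j' : T) :
  i != j -> i' != j' -> exists2 t : {perm T}, t i = i' & t j = j'.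
Proof.
(* The left factor acts first and sends [i] to [i']. The second brings the image of [j] to [j'] and
   fixes [i'], which differs from both points it swaps. *)
move=> ij ij'; exists (tperm i i' * tperm (tperm i i' j) j')%g.
  rewrite permM tpermL tpermD // 1?eq_sym //.
  by rewrite -{1}(tpermL i i') (inj_eq perm_inj).
by rewrite permM tpermL.
Qed.

Lemma sum_offdiag_const (R : pzRingType) (T : finType) (g : T -> T -> R)
    (a b : T) :
  (forall i j, i != j -> g i j = g a b) ->
  \sum_i \sum_(j | j != i) g i j = #|T|%:R * (#|T|%:R - 1) * g a b.
Proof.
move=> gE; transitivity (\sum_(i : T) (#|T|%:R - 1) * g a b).
  apply: eq_bigr => i _.
  rewrite (eq_bigr (fun=> g a b)) => [|j ji]; last by rewrite gE // eq_sym.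
  rewrite sumr_const -[LHS]mulr_natl; congr (_ * _).
  have -> : #|[pred j | j != i]| = #|T|.-1 by rewrite (cardC1 i).
  rewrite -subn1 natrB //.
  by apply/card_gt0P; exists i.
by rewrite sumr_const -[LHS]mulr_natl mulrA.
Qed.

(** By 2-transitivity the sum over [s] is the same for every pair of distinct points, so the left
    side is its sum over all such pairs. After exchanging the sums, each [s] merely permutes these
    pairs. *)
Lemma sum_perm_offdiag (R : comPzRingType) (T : finType) (h : T -> T -> R)
    (a b : T) : a != b ->
  #|T|%:R * (#|T|%:R - 1) * \sum_(s : {perm T}) h (s a) (s b)
  = #|{perm T}|%:R * \sum_i \sum_(j | j != i) h i j.
Proof.
move=> ab.
rewrite -(sum_offdiag_const (g := fun i j => \sum_(s : {perm T}) h (s i) (s j)))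
  => [|i j ij]; last first.
  have [t <- <-] := perm_two_transitive ab ij.
  rewrite [RHS](reindex_inj (mulgI t)).
  by apply: eq_bigr => s _; rewrite !permM.
transitivity (\sum_(s : {perm T}) \sum_i \sum_(j | j != i) h i j).
  under eq_bigr do rewrite exchange_big.
  rewrite exchange_big; apply: eq_bigr => s _ /=.
  rewrite [RHS](reindex_inj (@perm_inj _ s)); apply: eq_bigr => i _.
  rewrite [RHS](reindex_inj (@perm_inj _ s)).
  by apply: eq_bigl => j; rewrite (inj_eq perm_inj).
by rewrite sumr_const mulr_natl.
Qed.

(** * Permutations moving exactly [k] points *)

Lemma sum_nat_pred (T : finType) (P : pred T) :
  (\sum_i P i = #|[set i | P i]|)%N.
Proof.
by rewrite -sum1dep_card [RHS]big_mkcond; apply: eq_bigr => i _; case: (P i).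
Qed.

(** The points moved by [s ^ t] are the images under [t] of those moved by [s]. *)
Lemma sphere_id_conj (n k : nat) (s t : 'S_n) :
  ((s ^ t)%g \in sphere_id n k) = (s \in sphere_id n k).
Proof.
rewrite !inE -(card_imset [set i | s i != i] (@perm_inj _ t)).
congr (_ == _); apply: eq_card => i; rewrite inE.
rewrite -[i](permKV t) permJ (inj_eq perm_inj) mem_imset ?inE //.
exact: perm_inj.
Qed.

(** The witness is the cycle [0 -> 1 -> ... -> k-1 -> 0], extended by the identity; [2 <= k] ensures
    that it moves each of its points. The averages over the sphere thus have a nonzero
    denominator. *)
Lemma sphere_id_neq0 (n k : nat) : (2 <= k)%N -> (k <= n)%N ->
  (0 < #|sphere_id n k|)%N.
Proof.
move=> k2 kn.
have c_lt i : (i < n -> (if i < k then i.+1 %% k else i) < n)%N.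
  by case: ifP => // _ _; apply: leq_trans kn; rewrite ltn_mod; lia.
pose c (i : 'I_n) := Ordinal (c_lt i (ltn_ord i)).
have cE (i : nat) : (i < k -> i.+1 %% k = if i.+1 == k then 0 else i.+1)%N.
  move=> ik; case: eqP => [->|ne]; first by rewrite modnn.
  by rewrite modn_small //; lia.
have cI : injective c.
  move=> i j /(congr1 val) /= H; apply: val_inj => /=; move: H.
  case: ifP => ik; case: ifP => jk; rewrite ?cE //; do ?[case: eqP]; lia.
apply/card_gt0P; exists (perm cI); rewrite inE; apply/eqP.
transitivity #|[set widen_ord kn i | i : 'I_k]|; last first.
  rewrite card_imset ?card_ord // => i j /(congr1 val) /= ?; exact: val_inj.
apply: eq_card => i; rewrite inE permE -val_eqE /=.
case: ifP => ik.
  have -> : i = widen_ord kn (Ordinal ik) by exact: val_inj.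
  by rewrite imset_f // cE //=; case: ifP => [/eqP|_]; lia.
rewrite eqxx; apply/esym/imsetP => -[j _ /(congr1 val) /= E].
by rewrite E ltn_ord in ik.
Qed.

(** Double counting: by conjugation the sum is the same for every pair of distinct points, and each
    [s] in the sphere has [k(n-k)] pairs formed of a moved point and a fixed one. *)
Lemma card_sphere_id_move_fix (R : comPzRingType) (n k : nat) (a b : 'I_n) :
  a != b ->
  n%:R * (n%:R - 1)
    * \sum_(s in sphere_id n k) ((s a != a) && (s b == b))%:R
  = k%:R * (n%:R - k%:R) * #|sphere_id n k|%:R :> R.
Proof.
move=> ab; have := sum_offdiag_const
  (g := fun i j => \sum_(s in sphere_id n k)
                     ((s i != i) && (s j == j))%:R : R) (a := a) (b := b).
rewrite card_ord => <- => [|i j ij]; last first.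
  have [t <- <-] := perm_two_transitive ab ij.
  rewrite [LHS](reindex_inj (conjg_inj t)).
  apply: eq_big => s; first exact: sphere_id_conj.
  by move=> _; rewrite !permJ !(inj_eq perm_inj).
under eq_bigr do rewrite exchange_big.
rewrite exchange_big /=.
rewrite (eq_bigr (fun=> k%:R * (n%:R - k%:R))); first by rewrite sumr_const mulr_natr.
move=> s; rewrite inE => /eqP sk.
(* No point is both moved and fixed, so the diagonal terms vanish and can be added; the double sum
   then factors. *)
transitivity (\sum_i \sum_j (s i != i)%:R * (s j == j)%:R : R).
  apply: eq_bigr => i _; rewrite [RHS](bigD1 i) //=.
  rewrite [X in X + _](_ : _ = 0) ?add0r; last by rewrite -natrM mulnb andNb.
  by apply: eq_bigr => j _; rewrite -natrM mulnb.
rewrite -big_distrlr /=; congr (_ * _).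
  by rewrite -natr_sum sum_nat_pred sk.
rewrite -natr_sum sum_nat_pred -sk -natrB; last first.
  by rewrite -[leqRHS](card_ord n) max_card.
rewrite -[X in (X - _)%N](card_ord n) -(cardsC [set i | s i != i]) addKn.
by congr _%:R; apply: eq_card => i; rewrite !inE negbK.
Qed.

(** * The values of the objective and their averages *)

Section Qap.
Variables (R : realType) (n : nat).
Hypothesis hn : (4 <= n)%N.

Let i0 : 'I_n := Ordinal (ltn_trans (isT : (0 < 3)%N) hn).
Let i1 : 'I_n := Ordinal (ltn_trans (isT : (1 < 3)%N) hn).

Lemma matB_sym (i j : 'I_n) : matB R n i j = matB R n j i.
Proof. by rewrite !mxE eq_sym orbC. Qed.

Lemma qapE (s : 'S_n) :
  qap (matA R n) (matB R n) s = 2 * matB R n (s i0) (s i1).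
Proof.
have A0 i j : (i == i0) && (j == i1) || (i == i1) && (j == i0) = false ->
    matA R n i j = 0.
  by rewrite mxE -!val_eqE /= => ->.
have row i j : (i, j) = (i0, i1) \/ (i, j) = (i1, i0) ->
    \sum_j' matB R n (s i) (s j') * matA R n i j' = matB R n (s i) (s j).
  move=> H; rewrite (bigD1 j) //= big1 ?addr0 => [|j' j'j].
    by case: H => -[-> ->]; rewrite [matA _ _ _ _]mxE /= mulr1.
  rewrite A0 ?mulr0 //.
  by case: H j'j => -[-> ->] /negPf ->; rewrite !andbF //= -!val_eqE.
rewrite /qap (bigD1 i0) //= (row i0 i1); last by left.
rewrite (bigD1 i1) //= (row i1 i0); last by right.
rewrite big1 => [|i]; first by rewrite addr0 (matB_sym (s i1)); ring.
case/andP => /negPf ne0 /negPf ne1; apply: big1 => j _.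
by rewrite A0 ?mulr0 // ne0 ne1.
Qed.

(** This is the equation that determines [gam]: among the [n(n-1)] off-diagonal entries, [4(n-2)]
    equal [gam] and the others [1/2]. *)
Lemma sum_matB : \sum_i \sum_(j | j != i) matB R n i j = 0.
Proof.
pose x (i : 'I_n) : R := (i < 2)%N%:R.
have sx : \sum_i x i = 2.
  rewrite -natr_sum; congr _%:R.
  rewrite sum_nat_pred -sum1dep_card.
  by rewrite (big_ord_narrow (F := fun=> 1%N) (ltnW (ltnW hn))) sum1_card card_ord.
(* The last factor is the indicator that exactly one of [i], [j] is among the first two points. *)
have BE (i j : 'I_n) : j != i ->
    matB R n i j = 1/2 + (gam R n - 1/2) * (x i + x j - 2 * (x i * x j)).
  rewrite mxE eq_sym => /negPf ->; rewrite /x (leqNgt 2 i) (leqNgt 2 j).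
  by case: (i < 2)%N; case: (j < 2)%N => /=; ring.
transitivity (\sum_i ((n%:R - 1) / 2
    + (gam R n - 1/2) * ((n%:R - 2) * x i + 2 - 2 * 2 * x i + 2 * (x i * x i)))).
  apply: eq_bigr => i _; rewrite (eq_bigr _ (BE i)).
  (* The term [j = i] of the polynomial is added and subtracted, so that the sum runs over all
     [j]. *)
  transitivity (\sum_j (1/2 + (gam R n - 1/2) * (x i + x j - 2 * (x i * x j)))
      - (1/2 + (gam R n - 1/2) * (x i + x i - 2 * (x i * x i)))).
    by rewrite [in RHS](bigD1 i) //= addrAC subrr add0r.
  rewrite big_split /= sumr_const card_ord -mulr_sumr sumrB big_split /=.
  rewrite sumr_const card_ord sx -!mulr_sumr sx.
  by rewrite -[_ *+ n]mulr_natl -[x i *+ n]mulr_natl; ring.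
have xx i : x i * x i = x i by rewrite /x; case: (i < 2)%N; rewrite ?mulr1 ?mulr0.
under eq_bigr do rewrite xx.
have n2 : n%:R - 2 != 0 :> R.
  by rewrite subr_eq0 eqr_nat; lia.
rewrite big_split /= sumr_const card_ord -mulr_sumr big_split /= sumrB big_split /=.
rewrite -!mulr_sumr sx sumr_const card_ord.
rewrite -[_ / 2 *+ n]mulr_natl -[2 *+ n]mulr_natl /gam.
by field.
Qed.

Lemma one_sub_gam : 1 - 2 * gam R n = n%:R * (n%:R - 1) / (4 * (n%:R - 2)).
Proof.
have n2 : n%:R - 2 != 0 :> R by rewrite subr_eq0 eqr_nat; lia.
by rewrite /gam; field.
Qed.

Lemma one_sub_gam_ge0 : 0 <= 1 - 2 * gam R n.
Proof.
have n4 : 4 <= n%:R :> R by rewrite ler_nat.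
by rewrite one_sub_gam divr_ge0 ?mulr_ge0 //; lra.
Qed.

Lemma qap_le1 (s : 'S_n) : qap (matA R n) (matB R n) s <= 1.
Proof.
have := one_sub_gam_ge0; rewrite qapE mxE.
by case: ifP => _; [|case: ifP => _]; lra.
Qed.

(** At most one indicator is nonzero. If one is, the moved point cannot land on the fixed one, so it
    leaves the first two points and equality holds with value [2 * gam]. Otherwise the bound is
    [qap_le1]. *)
Lemma qap_le (s : 'S_n) :
  qap (matA R n) (matB R n) s
  <= 1 - (1 - 2 * gam R n) * (((s i0 != i0) && (s i1 == i1))%:R
                              + ((s i1 != i1) && (s i0 == i0))%:R).
Proof.
have ge2 (i : 'I_n) : i != i0 -> i != i1 -> (2 <= i)%N.
  by rewrite -!val_eqE /=; lia.
case: (eqVneq (s i0) i0) => e0; case: (eqVneq (s i1) i1) => e1 /=;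
  rewrite ?addr0 ?add0r ?mulr0 ?subr0 ?mulr1 ?qap_le1 // qapE.
- rewrite e0 mxE ifN; last by rewrite -e0 (inj_eq perm_inj).
  by rewrite ge2 //= ?opprB; [lra|rewrite -e0 (inj_eq perm_inj)].
- rewrite e1 matB_sym mxE ifN; last by rewrite -e1 (inj_eq perm_inj).
  by rewrite ge2 //= ?opprB; [lra|rewrite -e1 (inj_eq perm_inj)].
Qed.

Lemma average_qap : average [set: 'S_n] (qap (matA R n) (matB R n)) = 0.
Proof.
rewrite /average; under eq_bigr do rewrite qapE.
rewrite -mulr_sumr.
have := sum_perm_offdiag (matB R n) (isT : i0 != i1).
rewrite sum_matB mulr0 card_ord => /eqP.
(* The factor [n(n-1)] is nonzero and can be cancelled. *)
rewrite !mulf_eq0 subr_eq0 pnatr_eq0 pnatr_eq1 orbC => /orP[/eqP E|]; last by lia.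
under eq_bigl do rewrite inE.
by rewrite E !mulr0.
Qed.

Lemma average_sphere_qap (k : nat) : (2 <= k)%N -> (k <= n)%N ->
  average (sphere_id n k) (qap (matA R n) (matB R n))
  <= 1 - k%:R * (n%:R - k%:R) / (2 * (n%:R - 2)).
Proof.
move=> k2 kn; have n4 : 4 <= n%:R :> R by rewrite ler_nat.
have U0 : 0 < #|sphere_id n k|%:R :> R by rewrite ltr0n sphere_id_neq0.
rewrite /average mulrC ler_pdivrMr //.
apply: le_trans (ler_sum _ (fun s _ => qap_le s)) _.
rewrite sumrB sumr_const -mulr_sumr big_split /= one_sub_gam mulrBl mul1r.
rewrite lerD2l lerN2.
(* The two ordered pairs contribute equally, and the factor [n(n-1)] of each count cancels that of
   [1 - 2 * gam]. *)
have := @card_sphere_id_move_fix R n k i0 i1 isT.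
have := @card_sphere_id_move_fix R n k i1 i0 isT.
set S := \sum_(s in _) _; set S' := \sum_(s in _) _ => E E'.
suff -> : n%:R * (n%:R - 1) / (4 * (n%:R - 2)) * (S' + S)
  = k%:R * (n%:R - k%:R) / (2 * (n%:R - 2)) * #|sphere_id n k|%:R by [].
transitivity ((n%:R * (n%:R - 1) * S' + n%:R * (n%:R - 1) * S) / (4 * (n%:R - 2))).
  by ring.
by rewrite E E'; field; lra.
Qed.

End Qap.

Theorem mainTheorem8 (R : realType) (n : nat) (hn : (4 <= n)%N) :
  let f : 'S_n -> R := qap (matA R n) (matB R n) in
  [/\ average [set: 'S_n] f = 0,
      (forall s : 'S_n, f s <= 1) /\ f (1%g : 'S_n) = 1
    & forall k : nat, (2 <= k)%N -> (k <= n)%N ->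
        average (sphere_id n k) f
        <= (- (n%:R * k%:R) + k%:R ^+ 2 + 3 * n%:R - k%:R - 4)
             / (2 * n%:R - 4)].
Proof.
move=> f; split; first exact: average_qap.
  split=> [s|]; first exact: qap_le1.
  by rewrite /f (qapE R hn) !perm1 mxE /=; field.
move=> k k2 kn; apply: le_trans (average_sphere_qap R hn k2 kn) _.
have n4 : 4 <= n%:R :> R by rewrite ler_nat.
have kn' : k%:R <= n%:R :> R by rewrite ler_nat.
rewrite -subr_ge0.
(* The stated bound is weaker than the one just obtained, by [(n-k)/(2(n-2))]; they agree at
   [k = n]. *)
have -> : (- (n%:R * k%:R) + k%:R ^+ 2 + 3 * n%:R - k%:R - 4) / (2 * n%:R - 4)
  - (1 - k%:R * (n%:R - k%:R) / (2 * (n%:R - 2)))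
  = (n%:R - k%:R) / (2 * (n%:R - 2)) :> R by field; lra.
by rewrite divr_ge0 //; lra.
Qed.
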